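(* Let $\Pi=(\Pi_n)$ be an exchangeable Gibbs partition EGP$(\alpha,V)$ for some $\alpha\in(-\infty,1)$ and $V=(V_{n,k}:k\le n=1,2,\ldots)$. For each $n$ and each $1=i_1<i_2<\cdots<i_k\le n$, the probability that the record indices in $\Pi_n$ are $\mathbf{i}_n=(i_1,\ldots,i_k)$ is $$\bar\mu_{\alpha,V}(\mathbf{i}_n)=\psi_{\alpha,n,k}^{-1}(\mathbf{i}_n)\,V_{n,k},$$ where $$\psi_{\alpha,n,k}(\mathbf{i}_n)=\frac{\Gamma(1-\alpha)}{\Gamma(n-\alpha k)}\prod_{j=2}^{k}\frac{\Gamma(i_j-j\alpha)}{\Gamma(i_j-j\alpha-(1-\alpha))}.$$ Consequently the sequence $i_1,i_2,\ldots$ of record indices of $\Pi$ forms a non-homogeneous Markov chain starting at $i_1=1$ and with transition probabilities $$P_j(i_{j+1}\mid i_j)=(i_j-\alpha j)_{(i_{j+1}-i_j-1)}\,\frac{V_{i_{j+1},j+1}}{V_{i_j,j}},\qquad j\ge 1.$$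
   Context: Notation: $a_{(x)}=\Gamma(a+x)/\Gamma(a)$ (so $a_{(0)}=1$ and $a_{(r)}=a(a+1)\cdots(a+r-1)$ for positive integers $r$). A random partition of $[n]=\{1,\ldots,n\}$ is written $\Pi_n=(\Pi_{n1},\ldots,\Pi_{nk})$ with classes ordered by their least elements $1=i_1<i_2<\cdots<i_k\le n$; these are the record indices of $\Pi_n$. For a consistent family $\Pi=(\Pi_n)$ (a random partition of $\mathbb{N}$), the record indices of $\Pi$ are the least elements $i_1<i_2<\cdots$ of its classes, with $i_j=\infty$ if there are fewer than $j$ classes (so the transition probabilities above, over finite $i_{j+1}$, may sum to less than $1$, the missing mass being at $\infty$). Let $\alpha\in(-\infty,1]$ and let $V=(V_{n,k}:1\le k\le n)$ be nonnegative coefficients with $V_{1,1}=1$ and $V_{n,k}=(n-\alpha k)V_{n+1,k}+V_{n+1,k+1}$. The exchangeable Gibbs partition EGP$(\alpha,V)$ is the random partition $\Pi=(\Pi_n)$ of $\mathbb{N}$ generated by: $\Pi_1=(\{1\})$; for $n\ge1$, given $\Pi_n=(\pi_{n1},\ldots,\pi_{nk})$ with class sizes $n_j=|\pi_{nj}|$, the element $n+1$ starts a new class with probability $V_{n+1,k+1}/V_{n,k}$, and joins the class $\pi_{nj}$ with probability $\frac{n_j-\alpha}{n-\alpha k}\left(1-\frac{V_{n+1,k+1}}{V_{n,k}}\right)$, $j=1,\ldots,k$. Formulas with $V$ in a denominator are understood for states of positive probability. *)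

(* Defs.v *)
From HB Require Import structures.
From mathcomp Require Import all_boot all_order all_algebra.
From mathcomp Require Import finmap.
From mathcomp Require Import all_classical all_reals all_analysis.

Set Implicit Arguments.
Unset Strict Implicit.
Unset Printing Implicit Defensive.

Import Order.TTheory GRing.Theory Num.Theory.
Import numFieldNormedType.Exports.

Local Open Scope classical_set_scope.
Local Open Scope ring_scope.

(* Euler's integral; it is the Gamma function for x > 0 only (for x <= 0 the
   integral diverges and the value is meaningless). *)
Definition Gamma (R : realType) (x : R) : R :=
  fine (\int[lebesgue_measure]_(t in `]0%R, +oo[) (t `^ (x - 1) * expR (- t))%:E)%E.

(* a_(x) *)
Definition rising (R : realType) (a x : R) : R := Gamma (a + x) / Gamma a.

(* None stands for infinity, the infimum of the empty set. *)
Definition least (A : set nat) : option nat :=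
  match pselect (exists m, `[< A m >]) with
  | left h => Some (ex_minn h)
  | right _ => None
  end.

(* A partition of [n] is the list of its classes, ordered by least elements;
   an empty class would be skipped by pmap. *)
Definition record_indices (p : seq {fset nat}) : seq nat :=
  pmap (fun C : {fset nat} => least [set` C]) p.

Definition interval1 (n : nat) : {fset nat} := [fset m in iota 1 n]%fset.

Definition is_ordered_partition (n : nat) (p : seq {fset nat}) : Prop :=
  [/\ fset0 \notin p,
      pairwise (fun A B : {fset nat} => [disjoint A & B]%fset) p,
      (\bigcup_(C <- p) C)%fset = interval1 n &
      sorted ltn (record_indices p)].

(* trace on [n] of a partition of a larger set *)
Definition restrict_to (n : nat) (p : seq {fset nat}) : seq {fset nat} :=
  [seq C <- [seq (C `&` interval1 n)%fset | C <- p] | C != fset0].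

(* Element m joins the class of index j, where classes are numbered from 0. *)
Definition join_class (p : seq {fset nat}) (j m : nat) : seq {fset nat} :=
  set_nth fset0 p j (m |` nth fset0 p j)%fset.

Definition cprob (d : measure_display) (T : measurableType d) (R : realType)
    (P : probability T R) (A B : set T) : R :=
  fine (P (A `&` B)) / fine (P B).

(* A consistent family (Pi_n) of random partitions of the sets [n]; Pi_0 is
   necessarily the empty list.  There are countably many partitions of [n], so
   measurability is that of the fibres. *)
Record random_partition (d : measure_display) (T : measurableType d)
    (Pi : nat -> T -> seq {fset nat}) : Prop := {
  rp_measurable : forall n p, measurable [set w | Pi n w = p] ;
  rp_partition : forall n w, is_ordered_partition n (Pi n w) ;
  rp_consistent : forall n w, restrict_to n (Pi n.+1 w) = Pi n w
}.

Record gibbs_weights (R : realType) (alpha : R) (V : nat -> nat -> R) : Prop := {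
  gw_ge0 : forall n k, (1 <= k <= n)%N -> 0 <= V n k ;
  gw_11 : V 1%N 1%N = 1 ;
  gw_rec : forall n k, (1 <= k <= n)%N ->
    V n k = (n%:R - alpha * k%:R) * V n.+1 k + V n.+1 k.+1
}.

Record EGP (d : measure_display) (T : measurableType d) (R : realType)
    (P : probability T R) (alpha : R) (V : nat -> nat -> R)
    (Pi : nat -> T -> seq {fset nat}) : Prop := {
  egp_alpha : alpha <= 1 ;
  egp_weights : gibbs_weights alpha V ;
  egp_partition : random_partition Pi ;
  egp_start : forall w, Pi 1%N w = [:: [fset 1%N]%fset] ;
  egp_new : forall n p, (1 <= n)%N -> (0 < P [set w | Pi n w = p])%E ->
    cprob P [set w | Pi n.+1 w = rcons p [fset n.+1]%fset] [set w | Pi n w = p]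
    = V n.+1 (size p).+1 / V n (size p) ;
  egp_join : forall n p j, (1 <= n)%N -> (j < size p)%N ->
    (0 < P [set w | Pi n w = p])%E ->
    cprob P [set w | Pi n.+1 w = join_class p j n.+1] [set w | Pi n w = p]
    = (#|` nth fset0 p j|%:R - alpha) / (n%:R - alpha * (size p)%:R)
      * (1 - V n.+1 (size p).+1 / V n (size p))
}.

(* The j-th class (j >= 1) of the partition of N defined by (Pi_n); it is empty
   when there are fewer than j classes. *)
Definition nth_class (T : Type) (Pi : nat -> T -> seq {fset nat}) (j : nat)
    (w : T) : set nat :=
  \bigcup_n [set` nth fset0 (Pi n w) j.-1].

Definition record_index (T : Type) (Pi : nat -> T -> seq {fset nat}) (j : nat)
    (w : T) : option nat :=
  least (nth_class Pi j w).

(* psi_(alpha,n,k)(i_1, ..., i_k), where k = size s and i_j = nth 0 s j.-1.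
   All the arguments of Gamma are positive when alpha < 1 and s is a possible
   list of record indices of a partition of [n]. *)
Definition psi (R : realType) (alpha : R) (n : nat) (s : seq nat) : R :=
  Gamma (1 - alpha) / Gamma (n%:R - alpha * (size s)%:R)
  * \prod_(2 <= j < (size s).+1)
      (Gamma ((nth 0%N s j.-1)%:R - j%:R * alpha)
       / Gamma ((nth 0%N s j.-1)%:R - j%:R * alpha - (1 - alpha))).

(* Markov chain X_1, X_2, ... on a countable state space, started at x1, where
   p j x y is the probability of a transition from X_j = x to X_(j+1) = y. *)
Record markov_chain (d : measure_display) (T : measurableType d) (R : realType)
    (P : probability T R) (S : countType) (X : nat -> T -> S) (x1 : S)
    (p : nat -> S -> S -> R) : Prop := {
  mc_measurable : forall j x, (1 <= j)%N -> measurable [set w | X j w = x] ;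
  mc_start : P [set w | X 1%N w = x1] = 1%E ;
  mc_step : forall (j : nat) (h : nat -> S) (y : S), (1 <= j)%N ->
    (0 < P [set w | forall l, (1 <= l <= j)%N -> X l w = h l])%E ->
    cprob P [set w | X j.+1 w = y]
            [set w | forall l, (1 <= l <= j)%N -> X l w = h l]
    = p j (h j) y
}.

Definition record_trans_fin (R : realType) (alpha : R) (V : nat -> nat -> R)
    (j i i' : nat) : R :=
  if (i < i')%N
  then rising (i%:R - alpha * j%:R) (i'%:R - i%:R - 1) * (V i' j.+1 / V i j)
  else 0.

(* The mass missing from the finite states is at None, which is absorbing. *)
Definition record_trans (R : realType) (alpha : R) (V : nat -> nat -> R)
    (j : nat) (x y : option nat) : R :=
  match x, y with
  | Some i, Some i' => record_trans_fin alpha V j i i'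
  | Some i, None => 1 - fine (\sum_(0 <= m <oo) (record_trans_fin alpha V j i m)%:E)%E
  | None, Some _ => 0
  | None, None => 1
  end.

(* Main.v *)
Require Import Defs.
From HB Require Import structures.
From mathcomp Require Import all_boot all_order all_algebra.
From mathcomp Require Import finmap.
From mathcomp Require Import all_classical all_reals all_analysis.
From mathcomp Require Import measurable_realfun.
From mathcomp Require Import ring.

Set Implicit Arguments.
Unset Strict Implicit.
Unset Printing Implicit Defensive.

Import Order.TTheory GRing.Theory Num.Theory.
Import numFieldNormedType.Exports.

Local Open Scope classical_set_scope.
Local Open Scope ring_scope.

(* Given Pi_n with k classes, n+1 is a new record with probability
   V_(n+1,k+1) / V_(n,k), which depends on Pi_n through k only.  Summing over
   the countably many partitions with record indices s gives
     P(A_(n+1, s ++ [n+1])) = V_(n+1,k+1) / V_(n,k) * P(A_(n,s)),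
     P(A_(n+1, s)) = (1 - V_(n+1,k+1) / V_(n,k)) * P(A_(n,s)),
   where A_(n,s) is the event that Pi_n has record indices s.  By the recursion
   for V the second factor is (n - alpha k) V_(n+1,k) / V_(n,k), and the
   functional equation of Gamma identifies the resulting product with 1 / psi.
   For the Markov property, the history i_1 < ... < i_j up to the j-th record is
   the event A_(i_j, (i_1, ..., i_j)), and adding the next record i_(j+1) gives
   A_(i_(j+1), (i_1, ..., i_(j+1))). *)

(** * The Gamma function *)

Section gamma_integral.
Context {R : realType}.
Notation mu := (@lebesgue_measure R).
Implicit Types x t : R.

Definition gamma_integrand x t : R := t `^ (x - 1) * expR (- t).

(** Euler's integral before [fine] is applied: extended real values allow finiteness to be proved
    rather than hidden by the default value of [fine]. *)
Definition gamma_integral x : \bar R :=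
  (\int[mu]_(t in `]0%R, +oo[) (gamma_integrand x t)%:E)%E.

Lemma gamma_integrand_ge0 x t : 0 <= gamma_integrand x t.
Proof. by rewrite mulr_ge0 ?powR_ge0 ?expR_ge0. Qed.

Lemma measurable_gamma_integrand (D : set R) x :
  measurable_fun D (EFin \o gamma_integrand x).
Proof.
apply/measurable_EFinP; apply: measurable_funTS; apply: measurable_funM.
  exact: measurable_powR.
by apply: measurableT_comp => //; exact: measurable_funN.
Qed.

Lemma derivable_expRN t : derivable (fun t : R => expR (- t)) t 1.
Proof. by apply: ex_derive. Qed.

(** Disposes of the upper boundary term in the integration by parts. For an integer m >= x the
    exponential series gives e^y >= y^(m+1) / (m+1)!, so y^x e^(-y) <= (m+1)! / y when y >= 1. *)
Lemma powR_expRN_cvg0 (x : R) :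
  (n.+1%:R `^ x * expR (- n.+1%:R) : R) @[n --> \oo] --> (0 : R).
Proof.
have [m xm] : exists m : nat, x <= m%:R.
  by exists (Num.truncn `|x|).+1; rewrite (le_trans (ler_norm _))// ltW// truncnS_gt.
apply: (@squeeze_cvgr _ _ _ _ (fun=> 0) (fun n => (m.+1)`!%:R * harmonic n)); last 2 first.
- exact: cvg_cst.
- rewrite -(mulr0 (m.+1)`!%:R); apply: cvgMr; exact: cvg_harmonic.
apply: nearW => n; rewrite mulr_ge0 ?powR_ge0 ?expR_ge0//=.
rewrite expRN ler_pdivrMr ?expR_gt0// (@le_trans _ _ (n.+1%:R ^+ m))//.
  by rewrite -powR_mulrn// ler_powR// ler1n.
rewrite mulrAC ler_pdivlMr ?ltr0n// -exprSr mulrC -ler_pdivrMr ?ltr0n ?fact_gt0//.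
by apply: le_trans (expR_ge1Dxn m _); rewrite ?lerDr ?ler0n.
Qed.

(** The parts are t^x and the primitive -e^(-t); a compact interval away from 0 provides the
    required regularity even when x < 1. *)
Lemma gamma_by_parts x (a b : R) : 0 < x -> 0 < a -> a < b ->
  (\int[mu]_(t in `[a, b]) (gamma_integrand (x + 1) t)%:E
  = (a `^ x * expR (- a) - b `^ x * expR (- b))%:E
    + x%:E * \int[mu]_(t in `[a, b]) (gamma_integrand x t)%:E)%E.
Proof.
move=> x0 a0 ab.
have cexp : {within `[a, b], continuous (fun t : R => expR (- t))}.
  by apply: derivable_within_continuous => t _; exact: derivable_expRN.
have LR (f : R -> R) : {in `[a, b], forall t, derivable f t 1} ->
    derivable_oo_LRcontinuous f a b.
  move=> df; have cf := derivable_within_continuous df.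
  move: (cf) => /(continuous_within_itvP _ ab) [_ fa fb]; split => //.
  by move=> t tab; apply: df; exact: subset_itv_oo_cc.
have := @integration_by_parts R (fun t => t `^ x) (fun t => - expR (- t))
  (fun t => x * t `^ (x - 1)) (fun t => expR (- t)) a b ab.
rewrite {1}/gamma_integrand addrK => ->.
- rewrite 2!mulrN opprK (addrC (- (b `^ x * _))); congr (_ + _)%E.
  under eq_integral do rewrite mulrN -mulrA EFinN EFinM.
  rewrite integral_ge0N; last first.
    by move=> t _; rewrite lee_fin !mulr_ge0 ?powR_ge0 ?expR_ge0 ?ltW.
  rewrite oppeK ge0_integralZl_EFin ?ltW//.
  + by move=> t _; rewrite lee_fin gamma_integrand_ge0.
  exact: (measurable_gamma_integrand x).
- apply: derivable_within_continuous => t; rewrite in_itv/= => /andP[at_ _].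
  by apply: derivableM => //; apply: derivable_powR;
    rewrite in_itv/= andbT (lt_le_trans a0).
- by apply: LR => t; rewrite in_itv/= => /andP[at_ _]; apply: derivable_powR;
    rewrite in_itv/= andbT (lt_le_trans a0).
- move=> t; rewrite in_itv/= => /andP[at_ _]; apply: powR_derive1.
  by rewrite in_itv/= andbT (lt_trans a0).
- exact: cexp.
- by apply: LR => t _; apply: derivableN; exact: derivable_expRN.
- move=> t _; rewrite derive1E deriveN; last exact: derivable_expRN.
  by rewrite derive_val; rewrite mulrN1 opprK.
Qed.

(* Integration by parts on [1/(n+2), n+1], then monotone convergence. *)
Lemma gamma_integralS x : 0 < x ->
  gamma_integral (x + 1) = (x%:E * gamma_integral x)%E.
Proof.
move=> x0.
(* The index shift n+2 makes a_n < 1 <= b_n hold already at n = 0. *)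
pose a n : R := n.+2%:R^-1; pose b n : R := n.+1%:R.
have a0 n : 0 < a n by rewrite invr_gt0.
have ab n : a n < b n.
  by rewrite (@lt_le_trans _ _ 1) ?ler1n// invf_lt1 ?ltr1n ?ltr0n.
have cvgF y : (\int[mu]_(t in `[a n, b n]) (gamma_integrand y t)%:E @[n --> \oo]
    --> gamma_integral y)%E.
  have -> : gamma_integral y = (\int[mu]_(t in \bigcup_n [set` `[a n, b n]])
      (gamma_integrand y t)%:E)%E.
    congr (\int[mu]_(t in _) _)%E; apply/seteqP; split => t /=.
      rewrite in_itv/= andbT => t0.
      (* Any n above the integer parts of both t and 1/t puts t inside [a_n, b_n]. *)
      exists (maxn (Num.truncn t) (Num.truncn t^-1)) => //=; rewrite in_itv/=.
      rewrite invf_ple ?posrE// (@le_trans _ _ (Num.truncn t^-1).+1%:R)/=.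
      - rewrite (@le_trans _ _ (Num.truncn t).+1%:R)//.
        + by rewrite ltW// truncnS_gt.
        + by rewrite ler_nat ltnS leq_maxl.
      - by rewrite ltW// truncnS_gt.
      - by rewrite ler_nat ltnS (leq_trans _ (leqnSn _))// leq_maxr.
    by move=> [n _] /=; rewrite !in_itv/= andbT => /andP[+ _]; exact: lt_le_trans.
  apply: ge0_nondecreasing_set_cvg_integral => //.
  - move=> m n mn; apply/subsetPset => t /=; rewrite !in_itv/= => /andP[at_ tb].
    rewrite (le_trans _ at_) ?(le_trans tb) ?ler_nat//.
    by rewrite lef_pV2 ?posrE ?ltr0n// ler_nat !ltnS.
  - move=> n; exact: measurable_gamma_integrand.
  - by move=> n t _; rewrite lee_fin gamma_integrand_ge0.
(* At the lower end the boundary term is at most a_n^x, which tends to 0 because x > 0. *)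
have K0 : (a n `^ x * expR (- a n) - b n `^ x * expR (- b n)) @[n --> \oo] --> (0 : R).
  rewrite -(subr0 0); apply: cvgB; last exact: powR_expRN_cvg0.
  apply: (@squeeze_cvgr _ _ _ _ (fun=> 0) (fun n => a n `^ x)); last 2 first.
  - exact: cvg_cst.
  - have /cvg_at_rightP := powR_cvg0 x0; apply; split => //.
    have := @cvg_harmonic R; rewrite -cvg_shiftS; exact.
  apply: nearW => n; rewrite mulr_ge0 ?powR_ge0 ?expR_ge0//= ler_piMr ?powR_ge0//.
  by rewrite expR_le1 oppr_le0 ltW.
have := cvgF (x + 1).
rewrite (_ : (fun n => _) = (fun n =>
    (a n `^ x * expR (- a n) - b n `^ x * expR (- b n))%:E
    + x%:E * \int[mu]_(t in [set` `[a n, b n]]) (gamma_integrand x t)%:E)%E).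
  move/cvg_unique; apply => //.
  rewrite -[(x%:E * _)%E]add0e; apply: cvgeD => //; last by apply: cvgeZl.
  by apply: cvg_EFin => //; exact: nearW.
by apply/funext => n; exact: gamma_by_parts.
Qed.
Lemma gamma_integral1 : gamma_integral 1 = 1%E.
Proof.
rewrite /gamma_integral integral_itv_obnd_cbnd; last first.
  exact: measurable_gamma_integrand.
transitivity (\int[mu]_(t in `[0%R, +oo[) (expR (- t))%:E)%E.
  by apply: eq_integral => t _; rewrite /gamma_integrand subrr powRr0 mul1r.
have cexp (c : R) : continuous (fun t : R => c * expR (- t)).
  move=> t; apply/differentiable_continuous/derivable1_diffP.
  by apply: derivableM => //; exact: derivable_expRN.
rewrite (@ge0_continuous_FTC2y _ _ (fun t => -1 * expR (- t)) 0 (-1 * 0)).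
- by rewrite mulr0 oppr0 expR0 mulr1 EFinN oppeK add0e.
- by move=> t _; exact: expR_ge0.
- apply: continuous_subspaceT => t; have := cexp 1 t.
  by under eq_fun do rewrite mul1r.
- by apply: cvgMr; exact: cvgr_expR.
- by move=> t _; apply: derivableM => //; exact: derivable_expRN.
- apply: cvg_at_right_filter; exact: cexp.
- move=> t _; rewrite derive1E deriveM//.
  by rewrite !derive_val; rewrite mulrN1 scaleN1r opprK scaler0 addr0.
Qed.

Lemma gamma_integral_ge0 x : (0 <= gamma_integral x)%E.
Proof. by apply: integral_ge0 => t _; rewrite lee_fin gamma_integrand_ge0. Qed.

(** Three stages: positive integers by the functional equation from the value at 1; y >= 1 by the
    domination t^(y-1) <= 1 + t^n with n the integer part of y; the remaining x > 0 by pulling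
    finiteness back from x + 1. *)
Lemma gamma_integral_ltoo x : 0 < x -> (gamma_integral x < +oo)%E.
Proof.
have Gnat n : (gamma_integral n.+1%:R < +oo)%E.
  elim: n => [|n IH]; first by rewrite gamma_integral1 ltry.
  by rewrite -natr1 gamma_integralS ?ltr0n// lte_mul_pinfty//.
have G1 y : 1 <= y -> (gamma_integral y < +oo)%E.
  move=> y1; pose n := Num.truncn y.
  apply: (@le_lt_trans _ _ (gamma_integral 1 + gamma_integral n.+1%:R)%E).
    have g0 z t : (0 <= (gamma_integrand z t)%:E)%E.
      by rewrite lee_fin gamma_integrand_ge0.
    rewrite -ge0_integralD//; try exact: measurable_gamma_integrand.
    apply: ge0_le_integral => //.
    - exact: measurable_gamma_integrand.
    - by apply: emeasurable_funD; exact: measurable_gamma_integrand.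
    - move=> t /=; rewrite in_itv/= andbT => t0; rewrite -EFinD lee_fin.
      rewrite -mulrDl ler_wpM2r ?expR_ge0// subrr powRr0.
      have [t1|/ltW t1] := leP t 1.
        apply: ler_wpDr; first exact: powR_ge0.
        by rewrite -[leRHS](powRr0 t); apply: ger_powR; rewrite ?t0// subr_ge0.
      apply: ler_wpDl => //; apply: ler_powR => //.
      by rewrite lerD2r ltW// truncnS_gt.
  by rewrite gamma_integral1 lte_add_pinfty ?ltry.
move=> x0; rewrite ltey; apply/eqP => Goo.
have := G1 (x + 1); rewrite gamma_integralS// Goo gt0_muley ?lte_fin// lerDr ltW//.
by move=> /(_ isT); rewrite ltxx.
Qed.

(** On [1,2] the integrand is bounded below, since t^(x-1) >= 1/t >= 1/2 and e^(-t) >= e^(-2). *)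
Lemma gamma_integral_gt0 x : 0 < x -> (0 < gamma_integral x)%E.
Proof.
move=> x0.
apply: (@lt_le_trans _ _ (\int[mu]_(t in `[1%R, 2%R]) cst (2^-1 * expR (-2))%:E t)%E).
  rewrite integral_cst//= lebesgue_measure_itv/= lte_fin ltr1n -EFinB -EFinM lte_fin.
  by rewrite !mulr_gt0 ?expR_gt0 ?invr_gt0// subr_gt0 ltr1n.
apply: (@le_trans _ _ (\int[mu]_(t in `[1%R, 2%R]) (gamma_integrand x t)%:E)%E).
  apply: ge0_le_integral => //.
  - by move=> t _; rewrite lee_fin mulr_ge0 ?expR_ge0 ?invr_ge0.
  - exact: measurable_gamma_integrand.
  - move=> t /=; rewrite in_itv/= => /andP[t1 t2]; rewrite lee_fin.
    rewrite ler_pM ?expR_ge0 ?invr_ge0//.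
      rewrite (@le_trans _ _ t^-1)//.
        by rewrite lef_pV2 ?posrE ?(lt_le_trans _ t1).
      by rewrite -powR_inv1 ?(le_trans _ t1)// ler_powR// lerBrDr addNr ltW.
    by rewrite ler_expR lerN2.
apply: ge0_subset_integral => //.
- exact: measurable_gamma_integrand.
- by move=> t _; rewrite lee_fin gamma_integrand_ge0.
- by move=> t /=; rewrite !in_itv/= andbT => /andP[t1 _]; exact: lt_le_trans t1.
Qed.

Lemma GammaS x : 0 < x -> Gamma (x + 1) = x * Gamma x.
Proof.
move=> x0; rewrite /Gamma -/(gamma_integral (x + 1)) -/(gamma_integral x).
by rewrite gamma_integralS// fineM// ge0_fin_numE ?gamma_integral_ge0 ?gamma_integral_ltoo.
Qed.

Lemma Gamma_gt0 x : 0 < x -> 0 < Gamma x.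
Proof.
by move=> x0; apply: fine_gt0; rewrite gamma_integral_gt0// gamma_integral_ltoo.
Qed.

End gamma_integral.
(** * Record indices of ordered partitions *)

Lemma leastP (A : set nat) (m : nat) :
  least A = Some m <-> A m /\ forall k, A k -> (m <= k)%N.
Proof.
rewrite /least; case: pselect => [h|h]; last first.
  by split=> // -[Am _]; exfalso; apply: h; exists m; apply/asboolP.
case: ex_minnP => i /asboolP Ai mini; split=> [[<-]|[Am minm]].
  by split=> // k Ak; apply: mini; exact/asboolP.
by congr Some; apply/eqP; rewrite eqn_leq mini ?minm//; exact/asboolP.
Qed.

Lemma least_None (A : set nat) : least A = None <-> A = set0.
Proof.
rewrite /least; case: pselect => [[m Am]|h]; split => //.
- by move=> A0; exfalso; move: Am => /asboolP; rewrite A0.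
- by move=> _; apply/seteqP; split => // m Am; apply: h; exists m; apply/asboolP.
Qed.

Lemma least_fset_neq0 (C : {fset nat}) :
  C != fset0 -> exists2 m, m \in C & least [set` C] = Some m.
Proof.
move=> /fset0Pn [x xC].
case E : (least [set` C]) => [m|]; first by exists m => //; have /leastP[] := E.
by have /least_None/seteqP[/(_ x xC)] := E.
Qed.

Lemma least_fset0 : least [set` (fset0 : {fset nat})] = None.
Proof. by apply/least_None/seteqP; split. Qed.

Lemma least_fset1 (m : nat) : least [set` [fset m]%fset] = Some m.
Proof. by apply/leastP; split => [|k] /=; rewrite in_fset1// => /eqP ->. Qed.

Lemma in_interval1 (n m : nat) : (m \in interval1 n) = (0 < m <= n)%N.
Proof. by rewrite !inE/= mem_iota add1n ltnS. Qed.

Section ordered_partition.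
Variables (n : nat) (p : seq {fset nat}).
Hypothesis hp : is_ordered_partition n p.

Lemma class_neq0 (C : {fset nat}) : C \in p -> C != fset0.
Proof. by move=> Cp; case: hp => h _ _ _; apply: contraNneq h => <-. Qed.

Lemma class_sub (C : {fset nat}) (m : nat) : C \in p -> m \in C -> (0 < m <= n)%N.
Proof.
move=> Cp mC; case: hp => _ _ h _; rewrite -in_interval1 -h.
by apply/bigfcupP; exists C => //; rewrite Cp.
Qed.

(** No class is empty, so [pmap] skips nothing and positions in the two lists agree. Past the end
    both sides are [None], the default class [fset0] having no least element. *)
Lemma onth_record_indices (j : nat) :
  onth (record_indices p) j = least [set` nth fset0 p j].
Proof.
rewrite onthE pmapS_filter; have -> : [seq C : {fset nat} <- p | least [set` C]] = p.
  apply/all_filterP; apply/allP => C Cp.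
  by have [m _ ->] := least_fset_neq0 (class_neq0 Cp).
have [jp|pj] := ltnP j (size p); first by rewrite (nth_map fset0).
by rewrite !nth_default ?size_map// least_fset0.
Qed.

Lemma size_record_indices : size (record_indices p) = size p.
Proof.
rewrite size_pmap; apply/eqP; rewrite -all_count; apply/allP => C Cp.
by have [m _ ->] := least_fset_neq0 (class_neq0 Cp).
Qed.

Lemma record_indices_sub (m : nat) : m \in record_indices p -> (0 < m <= n)%N.
Proof.
rewrite mem_pmap => /mapP[C Cp /esym/leastP[mC _]]; exact: class_sub mC.
Qed.

End ordered_partition.

Lemma record_indices_rcons (n : nat) (p : seq {fset nat}) :
  record_indices (rcons p [fset n]%fset) = rcons (record_indices p) n.
Proof. by rewrite /record_indices -cats1 pmap_cat/= least_fset1 cats1. Qed.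

(** If {n+1} is a class, it comes last, as a later class would need a least element above n+1.
    Otherwise every class meets [n], and deleting n+1 changes no least element. *)
Lemma ordered_partitionS (n : nat) (q : seq {fset nat}) :
  is_ordered_partition n.+1 q ->
  q = rcons (restrict_to n q) [fset n.+1]%fset \/
  record_indices q = record_indices (restrict_to n q).
Proof.
move=> hq; have [inq|ninq] := boolP ([fset n.+1]%fset \in q); [left|right].
  move: inq hq => /splitPr[q1 q2] hq; have [_ dq _ sq] := hq.
  have q20 : q2 = [::].
    case: q2 hq dq sq => // C q2 hq _ sq; exfalso.
    have [|m mC mE] := @least_fset_neq0 C.
      by apply: (class_neq0 hq); rewrite mem_cat !inE eqxx !orbT.
    have := @class_sub _ _ hq C m; rewrite mem_cat !inE eqxx !orbT => /(_ isT mC).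
    move: sq; rewrite /record_indices pmap_cat/= least_fset1 mE/=.
    move=> /(subseq_sorted ltn_trans (suffix_subseq _ _))/= /andP[nm _].
    by rewrite [(m <= _)%N]leqNgt nm andbF.
  rewrite q20 cats1 in hq dq sq *; congr rcons.
  (* By disjointness from {n+1}, the other classes already lie in [n], so the restriction leaves
     them intact. *)
  have E (C : {fset nat}) : C \in q1 -> (C `&` interval1 n)%fset = C.
    move=> Cq1; apply/fsetIidPl/fsubsetP => m mC; rewrite in_interval1.
    have := class_sub hq _ mC; rewrite mem_rcons inE Cq1 orbT => /(_ isT).
    rewrite [(m <= _)%N]leq_eqVlt ltnS => /andP[-> /orP[/eqP mn|->//]].
    move: dq; rewrite -cats1 pairwise_cat => /andP[/allrelP/(_ C [fset n.+1]%fset Cq1)].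
    by rewrite inE eqxx => /(_ isT)/fdisjointP/(_ _ mC); rewrite mn in_fset1 eqxx.
  rewrite /restrict_to map_rcons filter_rcons.
  have -> : ([fset n.+1] `&` interval1 n)%fset = fset0.
    apply/fsetP => m; rewrite in_fsetI in_fset1 in_interval1 in_fset0.
    by case: eqP => //= ->; rewrite ltnn.
  rewrite eqxx/= (_ : [seq _ | C <- q1] = q1); last first.
    by rewrite -[RHS]map_id; apply/eq_in_map.
   apply/esym/all_filterP; apply/allP => C Cq1.
  by apply: (class_neq0 hq); rewrite mem_rcons inE Cq1 orbT.
have H (C : {fset nat}) :
    C \in q -> exists2 m, (0 < m <= n)%N & least [set` C] = Some m.
  move=> Cq; have [m mC mE] := least_fset_neq0 (class_neq0 hq Cq).
  have := class_sub hq Cq mC; rewrite [(m <= _)%N]leq_eqVlt ltnS.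
  move=> /andP[m0 /orP[/eqP mn|mn]].
    exfalso; move: ninq; rewrite (_ : [fset n.+1]%fset = C) ?Cq//.
    apply/fsetP => k; rewrite in_fset1; apply/eqP/idP => [->|kC]; first by rewrite -mn.
    have /andP[_ kn] := class_sub hq Cq kC; move/leastP : mE => [_ /(_ _ kC)].
    by rewrite mn => nk; apply/eqP; rewrite eqn_leq kn.
  by exists m => //; rewrite m0.
have H' (C : {fset nat}) : C \in q ->
    least [set` (C `&` interval1 n)%fset] = least [set` C].
  move=> /H[m mn mE]; rewrite mE; apply/leastP; move/leastP : mE => [mC mmin].
  split=> [|k] /=; rewrite in_fsetI in_interval1; first by apply/andP.
  by move=> /andP[kC _]; exact: mmin.
rewrite /restrict_to (_ : [seq C <- _ | _] = [seq (C `&` interval1 n)%fset | C <- q]).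
  rewrite /record_indices; elim: q H' {hq ninq H} => //= C q IH H'.
  rewrite H' ?mem_head// IH// => D Dq; apply: H'; by rewrite inE Dq orbT.
apply/all_filterP; apply/allP => _ /mapP[C Cq ->]; apply/eqP => C0.
by have [m _] := H _ Cq; rewrite -H'// C0 least_fset0.
Qed.

(** * Records of a consistent family of partitions *)

Section record_process.
Context (d : measure_display) (T : measurableType d).
Variable Pi : nat -> T -> seq {fset nat}.
Hypothesis hPi : random_partition Pi.
Implicit Types (w : T) (s : seq nat).
Notation ri n w := (record_indices (Pi n w)).

Lemma record_indicesS n w :
  Pi n.+1 w = rcons (Pi n w) [fset n.+1]%fset \/ ri n.+1 w = ri n w.
Proof.
by have := ordered_partitionS (rp_partition hPi n.+1 w); rewrite (rp_consistent hPi).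
Qed.

(** Passing from m to n only appends records, all of them beyond m; records once present keep their
    positions. *)
Lemma record_indices_cat m n w : (m <= n)%N ->
  exists2 t, ri n w = ri m w ++ t & all (fun i => m < i)%N t.
Proof.
elim: n => [|n IH].
  by rewrite leqn0 => /eqP->; exists [::]; rewrite ?cats0.
rewrite leq_eqVlt ltnS => /orP[/eqP->|mn]; first by exists [::]; rewrite ?cats0.
have [t tE mt] := IH mn.
have [->|->] := record_indicesS n w; last by exists t.
by exists (rcons t n.+1); rewrite ?record_indices_rcons ?tE ?rcons_cat// all_rcons ltnS mn.
Qed.

Lemma onth_record_indices_mono m n w j i : (m <= n)%N ->
  onth (ri m w) j = Some i -> onth (ri n w) j = Some i.
Proof.
move=> /record_indices_cat -/(_ w)[t -> _] E.
by rewrite onth_cat -onthTE E.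
Qed.

Lemma record_index_onth j w i :
  record_index Pi j w = Some i <-> exists n, onth (ri n w) j.-1 = Some i.
Proof.
have back n i' : onth (ri n w) j.-1 = Some i' -> record_index Pi j w = Some i'.
  move=> E; have := E.
  rewrite (onth_record_indices (rp_partition hPi n w)) => /leastP[i'n _].
  apply/leastP; split=> [|k [m _ /= km]]; first by exists n.
  case E' : (onth (ri m w) j.-1) => [l|]; last first.
    move: E'; rewrite (onth_record_indices (rp_partition hPi m w)) => /least_None.
    by move=> /seteqP[/(_ k km)].
  have /= := onth_record_indices_mono (leq_maxl m n) E'.
  rewrite (onth_record_indices_mono (leq_maxr m n) E) => -[->].
  by move: E'; rewrite (onth_record_indices (rp_partition hPi m w)) => /leastP[_]; exact.
split=> [E|[n]]; last exact: back.
have /leastP[[n _ /= ni] _] := E.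
exists n; case E' : (onth (ri n w) j.-1) => [l|]; first by rewrite -E -(back _ _ E').
move: E'; rewrite (onth_record_indices (rp_partition hPi n w)) => /least_None.
by move=> /seteqP[/(_ i ni)].
Qed.

(** Stage i suffices, because records appended after stage i exceed i. An event about the infinite
    partition thus becomes an event about a single [Pi i]. *)
Lemma record_indexE j w i :
  record_index Pi j w = Some i <-> onth (ri i w) j.-1 = Some i.
Proof.
rewrite record_index_onth; split=> [[n E]|]; last by exists i.
have iin : i \in ri n w by apply/onthP; exists j.-1.
have /andP[_ i_n] := record_indices_sub (rp_partition hPi n w) iin.
have [t tE it] := record_indices_cat w i_n.
move: E; rewrite tE onth_cat; case: ifP => // _ E.
have /(allP it) : i \in t by apply/onthP; exists (j.-1 - size (ri i w))%N.
by rewrite ltnn.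
Qed.

Lemma record_index_nth n j w : (j < size (ri n w))%N ->
  record_index Pi j.+1 w = Some (nth 0%N (ri n w) j).
Proof.
move=> jn; apply/record_index_onth; exists n => /=.
by rewrite onthE (nth_map 0%N).
Qed.

(** Read contrapositively, this makes [None] absorbing for the chain. *)
Lemma record_index_down j l w i : record_index Pi j w = Some i -> (l <= j)%N ->
  exists i', record_index Pi l w = Some i'.
Proof.
move=> /record_index_onth[n E] lj.
have : (l.-1 < size (ri n w))%N.
  have : (j.-1 < size (ri n w))%N by rewrite -onthTE E.
  by apply: leq_ltn_trans; rewrite -!subn1 leq_sub2r.
move=> lE; exists (nth 0%N (ri n w) l.-1); apply/record_index_onth; exists n.
by rewrite onthE (nth_map 0%N).
Qed.

Lemma record_indices_sorted n w : sorted ltn (ri n w).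
Proof. by have [] := rp_partition hPi n w. Qed.

(** The bridge between the two halves of the theorem: a finite history of the chain is the same
    event as a prescribed record list at the stage of its last record. *)
Lemma record_historyP s w : s != [::] ->
  (forall l, (l < size s)%N -> record_index Pi l.+1 w = Some (nth 0%N s l)) <->
  ri (last 0%N s) w = s.
Proof.
move=> s0; have ss0 : (0 < size s)%N by case: (s) s0.
split=> [H|E l ls]; last first.
  by rewrite (@record_index_nth (last 0%N s)) E.
set n := last 0%N s.
have nE : n = nth 0%N s (size s).-1 by rewrite nth_last.
have := H (size s).-1; rewrite prednK// -nE => /(_ (leqnn _)) /record_indexE E.
have sr : (size s <= size (ri n w))%N.
  by rewrite -[X in (X <= _)%N]prednK// -onthTE E.
have En : nth 0%N (ri n w) (size s).-1 = n by exact: onth_nth E.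
have ssE : size (ri n w) = size s.
  (* A further record at stage n would exceed the record n by strict monotonicity, yet all records
     at that stage are at most n. *)
  apply/eqP; rewrite eqn_leq sr andbT leqNgt; apply/negP => lt_s.
  have : (nth 0 (ri n w) (size s).-1 < nth 0 (ri n w) (size s))%N.
    apply: (sorted_ltn_nth ltn_trans 0%N (record_indices_sorted n w)) => //.
    - by rewrite inE prednK.
    - by rewrite prednK.
  rewrite En ltnNge => /negP; apply.
  by have /andP[] := record_indices_sub (rp_partition hPi n w) (mem_nth 0%N lt_s).
apply: (@eq_from_nth _ 0%N) => // l; rewrite ssE => ls.
have := @record_index_nth n l w; rewrite ssE => /(_ ls).
by rewrite H// => -[].
Qed.

Lemma measurable_partition n (D : set (seq {fset nat})) :
  measurable [set w | D (Pi n w)].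
Proof.
rewrite (_ : [set _ | _] = \bigcup_p
    (if `[< D p >] then [set w | Pi n w = p] else set0)).
  apply: countable_bigcupT_measurable => [|p]; first exact: countableP.
  by case: ifP => // _; exact: (rp_measurable hPi).
apply/seteqP; split=> [w Dw|w [p _]].
  by exists (Pi n w) => //=; case: asboolP.
by case: asboolP => // Dp /= ->.
Qed.

Lemma measurable_record_index j x :
  measurable [set w | record_index Pi j w = x].
Proof.
have mS i : measurable [set w | record_index Pi j w = Some i].
  rewrite (_ : [set _ | _] = [set w | onth (ri i w) j.-1 = Some i]).
    exact: (@measurable_partition i [set p | onth (record_indices p) j.-1 = Some i]).
  by apply/seteqP; split=> w /= /record_indexE.
case: x => [i|]; first exact: mS.
(* The value infinity is handled as the complement of the countably many finite values. *)
rewrite (_ : [set _ | _] = ~` \bigcup_i [set w | record_index Pi j w = Some i]).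
  by apply: measurableC; apply: bigcup_measurable => i _.
apply/seteqP; split=> w /=; first by move=> E [i _] /=; rewrite E.
by case E : (record_index Pi j w) => [i|] // H; exfalso; apply: H; exists i.
Qed.

End record_process.
(** * The law of the record indices *)

Lemma cprobE (d : measure_display) (T : measurableType d) (R : realType)
    (P : probability T R) (A B : set T) (r : R) :
  measurable A -> measurable B -> (0 < P B)%E ->
  cprob P A B = r <-> P (A `&` B) = (r%:E * P B)%E.
Proof.
move=> mA mB PB0; rewrite /cprob.
have fB : P B \is a fin_num by exact: fin_num_measure.
have fAB : P (A `&` B) \is a fin_num by apply: fin_num_measure; exact: measurableI.
have PB0' : fine (P B) != 0 by rewrite gt_eqF// fine_gt0// PB0 ltey_eq fB.
split=> [<-|->]; last by rewrite fineM// mulfK.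
by rewrite -[in RHS](fineK fB) -EFinM divfK// fineK.
Qed.

(** A conditional probability that is constant over the fibres of a countable-valued variable is
    unchanged by merging fibres. Null fibres are allowed, as the hypothesis is in product form. *)
Lemma measure_fibres (d : measure_display) (T : measurableType d) (R : realType)
    (P : {measure set T -> \bar R}) (S : countType) (X : T -> S) (D : set S)
    (E : set T) (r : R) :
  (forall p, measurable [set w | X w = p]) -> measurable E ->
  (forall p, D p ->
    P (E `&` [set w | X w = p]) = (r%:E * P [set w | X w = p])%E) ->
  P (E `&` [set w | D (X w)]) = (r%:E * P [set w | D (X w)])%E.
Proof.
move=> mX mE H.
(* Fibres are indexed by their integer codes, so that countable additivity over subsets of the
   naturals applies. *)
pose F k := [set w | choice.pickle (X w) = k].
pose K := choice.pickle @` D.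
have FE p : F (choice.pickle p) = [set w | X w = p].
  by apply/seteqP; split=> w; rewrite /F/=; [move/(pcan_inj choice.pickleK)|move=> ->].
have DE : [set w | D (X w)] = \bigcup_(k in K) F k.
  apply/seteqP; split=> [w /= Dw|w [_ [p Dp <-]]]; last by rewrite FE /= => ->.
  by exists (choice.pickle (X w)) => //; exists (X w).
have mF k : K k -> measurable (F k) by move=> [p _ <-]; rewrite FE.
have tF (G : set T) : trivIset K (fun k => G `&` F k).
  by move=> k l _ _ [w [[_ /= <-] [_ /= <-]]].
rewrite DE setI_bigcupr !measure_bigcup//; last 2 first.
- by move=> k l _ _ [w [/= <- /= <-]].
- by move=> k Kk; apply: measurableI => //; exact: mF.
rewrite -nneseriesZl//; apply: eq_eseriesr => k /set_mem[p Dp <-].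
by rewrite FE H.
Qed.

(** * Algebra of psi and of the weights V *)

Section gibbs.
Context (R : realType) (alpha : R) (V : nat -> nat -> R).
Hypothesis alpha_lt1 : alpha < 1.

Lemma gibbs_arg_gt0 n k : (0 < k <= n)%N -> 0 < n%:R - alpha * k%:R.
Proof.
move=> /andP[k0 kn].
rewrite [ltRHS](_ : _ = (n%:R - k%:R) + (1 - alpha) * k%:R); last by ring.
by rewrite ltr_wpDl ?subr_ge0 ?ler_nat// mulr_gt0 ?subr_gt0 ?ltr0n.
Qed.

(** The factor of the new record n+1 is Gamma(n+1 - alpha (k+1)) / Gamma(n - alpha k). Its numerator
    cancels the new prefactor, and its denominator restores the prefactor at n. *)
Lemma psi_rcons n s : (0 < size s <= n)%N ->
  psi alpha n.+1 (rcons s n.+1) = psi alpha n s.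
Proof.
move=> sn; have /andP[s0 sn'] := sn; rewrite /psi size_rcons big_nat_recr//=.
have -> : \prod_(2 <= i < (size s).+1)
    (Gamma ((nth 0 (rcons s n.+1) i.-1)%:R - i%:R * alpha) /
     Gamma ((nth 0 (rcons s n.+1) i.-1)%:R - i%:R * alpha - (1 - alpha))) =
  \prod_(2 <= i < (size s).+1)
    (Gamma ((nth 0 s i.-1)%:R - i%:R * alpha) /
     Gamma ((nth 0 s i.-1)%:R - i%:R * alpha - (1 - alpha))).
  apply: eq_big_nat => -[//|i] /andP[_]; rewrite ltnS => si.
  by rewrite nth_rcons si.
rewrite nth_rcons ltnn eqxx.
have -> : n.+1%:R - (size s).+1%:R * alpha - (1 - alpha) = n%:R - alpha * (size s)%:R.
  by rewrite -!natr1; ring.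
have G0 : Gamma (n.+1%:R - alpha * (size s).+1%:R) != 0.
  by rewrite gt_eqF// Gamma_gt0// gibbs_arg_gt0.
have G1 : Gamma (n%:R - alpha * (size s)%:R) != 0.
  by rewrite gt_eqF// Gamma_gt0// gibbs_arg_gt0.
rewrite (mulrC (size s).+1%:R) mulrACA mulrCA; field.
by rewrite G0 G1.
Qed.

(** Only the prefactor of [psi] depends on n. The Gamma ratio becomes the rising factorial of the
    transition probabilities. *)
Lemma psi_shift n m s : (0 < size s <= n)%N -> (n <= m)%N ->
  psi alpha n s
  = Gamma (m%:R - alpha * (size s)%:R) / Gamma (n%:R - alpha * (size s)%:R)
    * psi alpha m s.
Proof.
move=> sn nm; rewrite /psi mulrA; congr (_ * _).
have sm : (0 < size s <= m)%N by case/andP: sn => -> /leq_trans; exact.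
by field; rewrite !gt_eqF ?Gamma_gt0 ?gibbs_arg_gt0.
Qed.

Lemma psiS n s : (0 < size s <= n)%N ->
  (psi alpha n.+1 s)^-1 = (n%:R - alpha * (size s)%:R) * (psi alpha n s)^-1.
Proof.
move=> sn; have a0 := gibbs_arg_gt0 sn.
rewrite (psi_shift sn (leqnSn n)) -natr1 addrAC GammaS//.
by rewrite mulfK ?gt_eqF ?Gamma_gt0// [in RHS]invfM mulVKf ?gt_eqF.
Qed.

Lemma psi1 : psi alpha 1 [:: 1%N] = 1.
Proof.
rewrite /psi/= mulr1 big_geq// mulr1 divff// gt_eqF// Gamma_gt0// subr_gt0//.
Qed.

Hypothesis hV : gibbs_weights alpha V.

(** Both terms of the recursion are nonnegative and n - alpha k > 0. Zero weights therefore
    propagate, which settles the states where V stands in a denominator and vanishes. *)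
Lemma gibbs_weights_eq0 n k : (0 < k <= n)%N -> V n k = 0 ->
  V n.+1 k = 0 /\ V n.+1 k.+1 = 0.
Proof.
move=> kn; have /andP[k0 kn'] := kn; rewrite (gw_rec hV) => // /eqP.
have a0 := gibbs_arg_gt0 kn.
have V1 : 0 <= V n.+1 k by apply: (gw_ge0 hV); rewrite k0 leqW.
have V2 : 0 <= V n.+1 k.+1 by apply: (gw_ge0 hV).
rewrite paddr_eq0 ?mulr_ge0 ?(ltW a0)// mulf_eq0 gt_eqF//= => /andP[/eqP ? /eqP ?].
by [].
Qed.

End gibbs.

(** A strictly increasing list starting at 1 has its entry of index i (counted from 0) above i. *)
Lemma size_sorted_le (s : seq nat) : nth 0%N s 0 = 1%N -> sorted ltn s ->
  (0 < size s <= last 0%N s)%N.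
Proof.
move=> s1; have s0 : (0 < size s)%N by case: (s) s1.
move=> ss; rewrite s0 -nth_last.
suff H i : (i < size s)%N -> (i < nth 0 s i)%N.
  by have := H (size s).-1; rewrite prednK// => /(_ (leqnn _)).
elim: i => [|i IH] i_s; first by rewrite s1.
rewrite (leq_ltn_trans (IH (ltnW i_s)))//.
by apply: (sorted_ltn_nth ltn_trans 0%N ss) => //; rewrite inE ltnW.
Qed.

(** * Law of the record list at a fixed stage *)

Section gibbs_partition.
Context (d : measure_display) (T : measurableType d) (R : realType).
Context (P : probability T R) (alpha : R) (V : nat -> nat -> R).
Variable Pi : nat -> T -> seq {fset nat}.
Hypotheses (alpha_lt1 : alpha < 1) (hPi : EGP P alpha V Pi).
Implicit Types (w : T) (s : seq nat) (n : nat).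
Notation ri n w := (record_indices (Pi n w)).
Let hp := egp_partition hPi.

Lemma new_class_prob n s : (0 < n)%N ->
  P ([set w | Pi n.+1 w = rcons (Pi n w) [fset n.+1]%fset] `&` [set w | ri n w = s])
  = ((V n.+1 (size s).+1 / V n (size s))%:E * P [set w | ri n w = s])%E.
Proof.
move=> n0.
have mE : measurable [set w | Pi n.+1 w = rcons (Pi n w) [fset n.+1]%fset].
  rewrite (_ : [set _ | _] = \bigcup_p ([set w | Pi n w = p] `&`
      [set w | Pi n.+1 w = rcons p [fset n.+1]%fset])).
    apply: countable_bigcupT_measurable => [|p]; first exact: countableP.
    by apply: measurableI; exact: (rp_measurable hp).
  by apply/seteqP; split=> [w /= E|w [p _ [/= <- ->]]//]; exists (Pi n w).
apply: (@measure_fibres _ _ _ _ _ (Pi n) [set p | record_indices p = s]) => //.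
  exact: (rp_measurable hp).
move=> p /= ps.
have -> : [set w | Pi n.+1 w = rcons (Pi n w) [fset n.+1]%fset] `&` [set w | Pi n w = p]
    = [set w | Pi n.+1 w = rcons p [fset n.+1]%fset] `&` [set w | Pi n w = p].
  by apply/seteqP; split=> w /= [E wp]; rewrite E wp.
(* On a null partition the rule for new classes says nothing, but both sides are 0. *)
have [P0|] := eqVneq (P [set w | Pi n w = p]) 0%E.
  rewrite P0 mule0; apply/eqP; rewrite -measure_le0 -P0 le_measure ?inE//.
  - by apply: measurableI; exact: (rp_measurable hp).
  - exact: (rp_measurable hp).
rewrite -measure_gt0 => P0.
(* An arbitrary p with record list s might contain empty classes; positive probability makes it a
   value of [Pi n], hence a genuine partition. *)
have -> : size s = size p.
  have [w wp] : [set w | Pi n w = p] !=set0.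
    by apply/set0P/eqP => E; move: P0; rewrite E measure0 ltxx.
  by rewrite -ps -wp (size_record_indices (rp_partition hp n w)).
apply/cprobE => //; [exact: (rp_measurable hp)..|].
exact: (egp_new hPi).
Qed.

Lemma measurable_records n s : measurable [set w | ri n w = s].
Proof. exact: (measurable_partition hp n [set p | record_indices p = s]). Qed.

Lemma records_new n s : (0 < n)%N ->
  P [set w | ri n.+1 w = rcons s n.+1]
  = ((V n.+1 (size s).+1 / V n (size s))%:E * P [set w | ri n w = s])%E.
Proof.
move=> n0; rewrite -new_class_prob//; congr (P _); apply/seteqP; split=> w /=.
  have [pE|rE] := record_indicesS hp n w.
    by rewrite pE record_indices_rcons => /eqP; rewrite eqseq_rcons => /andP[/eqP].
  rewrite rE => E; exfalso.
  have := @record_indices_sub _ _ (rp_partition hp n w) n.+1.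
  by rewrite E mem_rcons mem_head => /(_ isT); rewrite ltnn andbF.
by move=> [-> <-]; rewrite record_indices_rcons.
Qed.

(** The event at stage n+1 is the event at stage n minus that of a new record at n+1. The bound on
    the last entry excludes lists that end in n+1. *)
Lemma records_old n s : (0 < n)%N -> (last 0 s <= n)%N ->
  P [set w | ri n.+1 w = s]
  = ((1 - V n.+1 (size s).+1 / V n (size s))%:E * P [set w | ri n w = s])%E.
Proof.
move=> n0 sn.
have mE := measurable_records n s.
have -> : [set w | ri n.+1 w = s]
    = [set w | ri n w = s] `\` [set w | ri n.+1 w = rcons s n.+1].
  apply/seteqP; split=> w /=; have [pE|rE] := record_indicesS hp n w.
  - rewrite pE record_indices_rcons => E; move: sn; rewrite -E last_rcons.
    by rewrite ltnn.
  - rewrite rE => ->; split=> // /(congr1 size); rewrite size_rcons => /n_Sn; exact.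
  - by rewrite pE record_indices_rcons => -[<-].
  - by rewrite rE => -[].
rewrite measureD//; last by rewrite ltey_eq fin_num_measure.
  rewrite (_ : _ `&` _ = [set w | ri n.+1 w = rcons s n.+1]).
    rewrite [X in (_ - X)%E](records_new s n0) EFinB muleBl ?mul1e ?fin_num_measure//.
  apply/seteqP; split=> w /=; first by case.
  move=> E; split=> //; move: E.
  have [pE|->] := record_indicesS hp n w.
    by rewrite pE record_indices_rcons => /eqP; rewrite eqseq_rcons => /andP[/eqP].
  move=> E; exfalso.
  have := @record_indices_sub _ _ (rp_partition hp n w) n.+1.
  by rewrite E mem_rcons mem_head => /(_ isT); rewrite ltnn andbF.
exact: measurable_records.
Qed.

Lemma records1 w : ri 1 w = [:: 1%N].
Proof. by rewrite (egp_start hPi) (@record_indices_rcons 1 [::]). Qed.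

(** Induction on n: a last entry at most n uses [records_old] and [psiS], a last entry n+1 uses
    [records_new] and [psi_rcons]. *)
Lemma records_prob n s : nth 0%N s 0 = 1%N -> sorted ltn s -> (last 0%N s <= n)%N ->
  P [set w | ri n w = s] = ((psi alpha n s)^-1 * V n (size s))%:E.
Proof.
elim: n s => [|n IH] s s1 ss.
  by have /andP[s0 sl] := size_sorted_le s1 ss; rewrite leqNgt (leq_trans s0).
have /andP[s0 sl] := size_sorted_le s1 ss.
rewrite leq_eqVlt ltnS => /orP[/eqP sn|sn]; last first.
  have n0 : (0 < n)%N := leq_trans s0 (leq_trans sl sn).
  have sn' : (0 < size s <= n)%N by rewrite s0 (leq_trans sl).
  rewrite records_old// IH// -EFinM psiS//; congr EFin.
  (* If the weight vanishes, so does its successor, and both sides are 0 whatever the quotient by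
     zero means. *)
  have [V0|V0] := eqVneq (V n (size s)) 0.
    by have [-> _] := gibbs_weights_eq0 alpha_lt1 (egp_weights hPi) sn' V0;
      rewrite V0 !mulr0.
  have := gw_rec (egp_weights hPi) sn'; move: V0 => /[swap].
  move=> E V0; rewrite mulrCA mulrBl mul1r divfK// [in LHS]E; ring.
case/lastP: s s1 ss s0 sl sn => // s i s1 ss s0 sl.
rewrite last_rcons => iE; move: s1 ss s0 sl; rewrite {}iE => s1 ss s0 sl.
(* A one-element list has its only entry equal to both 1 and n+1, so n = 0 and the event is
   certain. *)
case: s s1 ss s0 sl => [|i0 s] s1 ss s0 sl.
  move: s1 => /= -[->]; rewrite psi1// (gw_11 (egp_weights hPi)) invr1 mulr1.
  by rewrite (_ : [set _ | _] = setT) ?probability_setT//;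
    apply/seteqP; split=> // w _; exact: records1.
set s' := i0 :: s in s1 ss s0 sl *.
have s1' : nth 0%N s' 0 = 1%N by [].
have ss' : sorted ltn s' by move: ss; rewrite -cats1 => /cat_sorted2[].
have sn' : (last 0%N s' <= n)%N.
  by move: ss; rewrite /s' rcons_cons/= rcons_path => /andP[_].
have /andP[s0' sl'] := size_sorted_le s1' ss'.
have n0 : (0 < n)%N := leq_trans s0' (leq_trans sl' sn').
have sz : (0 < size s' <= n)%N by rewrite s0' (leq_trans sl').
rewrite records_new// IH// -EFinM psi_rcons// size_rcons; congr EFin.
have [V0|V0] := eqVneq (V n (size s')) 0.
  by have [_ ->] := gibbs_weights_eq0 alpha_lt1 (egp_weights hPi) sz V0;
    rewrite V0 !mulr0.
by rewrite mulrCA divfK.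
Qed.

End gibbs_partition.

(** * The Markov chain of record indices *)

Section record_markov_chain.
Context (d : measure_display) (T : measurableType d) (R : realType).
Context (P : probability T R) (alpha : R) (V : nat -> nat -> R).
Variable Pi : nat -> T -> seq {fset nat}.
Hypotheses (alpha_lt1 : alpha < 1) (hPi : EGP P alpha V Pi).
Implicit Types (w : T) (s : seq nat) (n : nat).
Notation ri n w := (record_indices (Pi n w)).
Let hp := egp_partition hPi.

(** The point w0 shows that the history is possible; from it come finiteness of the earlier values,
    strict monotonicity and the initial value 1. *)
Lemma history_records j (h : nat -> option nat) i w0 : (0 < j)%N ->
  h j = Some i ->
  (forall l, (1 <= l <= j)%N -> record_index Pi l w0 = h l) ->
  exists s, [/\ size s = j, last 0%N s = i, nth 0%N s 0 = 1%N, sorted ltn s &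
    [set w | forall l, (1 <= l <= j)%N -> record_index Pi l w = h l]
      = [set w | ri i w = s]].
Proof.
(* The default 0 is never reached, since all values up to index j are finite. *)
move=> j0 hj h0; pose s := mkseq (fun l => odflt 0%N (h l.+1)) j.
have sz : size s = j by rewrite size_mkseq.
have sl : last 0%N s = i by rewrite -nth_last sz nth_mkseq ?prednK// hj.
have s_neq0 : s != [::] by rewrite -size_eq0 sz -lt0n.
have hs l : (l < j)%N -> h l.+1 = Some (nth 0%N s l).
  move=> lj; rewrite nth_mkseq// -h0//.
  have [|i' ->//] := @record_index_down _ _ _ hp j l.+1 w0 i _ lj.
  by rewrite h0 ?j0 ?leqnn.
have E : [set w | forall l, (1 <= l <= j)%N -> record_index Pi l w = h l]
      = [set w | ri i w = s].
  apply/seteqP; split=> w /=; rewrite -[X in ri X _]sl.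
    move=> H; apply/(record_historyP hp w s_neq0) => l; rewrite sz => lj.
    by rewrite H// hs.
  move/(record_historyP hp w s_neq0) => H [//|l] /= lj.
  by rewrite H ?sz// hs.
have rs : ri i w0 = s by have : [set w | ri i w = s] w0 by rewrite -E.
exists s; split=> //; last by rewrite -rs; exact: (record_indices_sorted hp).
have i0 : (0 < i)%N.
  have is_ : i \in ri i w0 by rewrite rs -sl -nth_last mem_nth// prednK sz.
  by have /andP[] := record_indices_sub (rp_partition hp i w0) is_.
have [t tE _] := record_indices_cat hp w0 i0.
by rewrite -rs tE (records1 hPi).
Qed.

(** History and next record together form the record list extended by i', at stage i'. The
    probability is then a ratio of two instances of [records_prob]; for i' <= i the list is not
    increasing and the event is empty. *)
Lemma record_step_fin s i i' : nth 0%N s 0 = 1%N -> sorted ltn s ->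
  last 0%N s = i -> (0 < P [set w | ri i w = s])%E ->
  P ([set w | record_index Pi (size s).+1 w = Some i'] `&` [set w | ri i w = s])
  = ((record_trans_fin alpha V (size s) i i')%:E * P [set w | ri i w = s])%E.
Proof.
move=> s1 ss sl PB; have /andP[s0 si] := size_sorted_le s1 ss.
rewrite sl in si.
have s_neq0 : s != [::] by rewrite -size_eq0 -lt0n.
have -> : [set w | record_index Pi (size s).+1 w = Some i'] `&` [set w | ri i w = s]
    = [set w | ri i' w = rcons s i'].
  have rs_neq0 : rcons s i' != [::] by rewrite -size_eq0 size_rcons.
  apply/seteqP; split=> w /=.
    move=> [E]; rewrite -[X in ri X _]sl => /(record_historyP hp w s_neq0) H.
    rewrite -[X in ri X _](last_rcons 0%N s i').
    apply/(record_historyP hp w rs_neq0) => l; rewrite size_rcons ltnS leq_eqVlt.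
    case/orP => [/eqP ->|ls]; first by rewrite nth_rcons ltnn eqxx.
    by rewrite nth_rcons ls H.
  rewrite -[X in ri X _](last_rcons 0%N s i') => /(record_historyP hp w rs_neq0) H.
  split; first by rewrite H ?size_rcons// nth_rcons ltnn eqxx.
  rewrite -[X in ri X _]sl; apply/(record_historyP hp w s_neq0) => l ls.
  by rewrite H ?size_rcons ?ltnS ?(ltnW ls)// nth_rcons ls.
rewrite /record_trans_fin; case: ifPn => [ii'|]; last first.
  rewrite -leqNgt => i'i; rewrite mul0e.
  rewrite (_ : [set _ | _] = set0) ?measure0//; apply/seteqP; split=> w //= E.
  have := record_indices_sorted hp i' w; rewrite E.
  case: (s) s0 sl => // a s' _ /= sl; rewrite rcons_path => /andP[_].
  by rewrite sl /= ltnNge i'i.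
case: i' ii' => // n; rewrite ltnS => i_n.
have sz : (0 < size s <= i)%N by rewrite s0.
have szn : (0 < size s <= n)%N by rewrite s0 (leq_trans si).
have ss' : sorted ltn (rcons s n.+1).
  case: (s) s0 ss sl => // a s' _ /=; rewrite rcons_path => -> ->.
  by rewrite /= ltnS.
have s1' : nth 0%N (rcons s n.+1) 0 = 1%N by rewrite nth_rcons s0.
rewrite (records_prob alpha_lt1 hPi s1' ss') ?last_rcons//.
have BE : P [set w | ri i w = s] = ((psi alpha i s)^-1 * V i (size s))%:E.
  by apply: (records_prob alpha_lt1 hPi) => //; rewrite sl.
move: PB; rewrite BE lte_fin => PB; rewrite -EFinM; congr EFin.
have V0 : V i (size s) != 0 by apply: contraTneq PB => ->; rewrite mulr0 ltxx.
(* With i' = n+1, the last record is dropped from [psi], and the shift from stage i to n = i' - 1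
   produces the rising factorial. *)
rewrite size_rcons psi_rcons// (psi_shift alpha_lt1 sz i_n) /rising.
have -> : i%:R - alpha * (size s)%:R + (n.+1%:R - i%:R - 1)
    = n%:R - alpha * (size s)%:R :> R.
  by rewrite -natr1; ring.
rewrite [in RHS]invfM invf_div mulrA.
have G0 m : (0 < size s <= m)%N -> Gamma (m%:R - alpha * (size s)%:R) != 0.
  by move=> h; rewrite gt_eqF ?Gamma_gt0 ?gibbs_arg_gt0.
move: (psi alpha n s)^-1 => x; field.
by rewrite V0 !G0.
Qed.

(** The complement of the finite next records within the history, evaluated by countable
    additivity. *)
Lemma record_step_None s i : nth 0%N s 0 = 1%N -> sorted ltn s ->
  last 0%N s = i -> (0 < P [set w | ri i w = s])%E ->
  P ([set w | record_index Pi (size s).+1 w = None] `&` [set w | ri i w = s])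
  = ((record_trans alpha V (size s) (Some i) None)%:E * P [set w | ri i w = s])%E.
Proof.
move=> s1 ss sl PB.
set B := [set w | ri i w = s].
have mB : measurable B by exact: (measurable_records hPi).
pose X m := [set w | record_index Pi (size s).+1 w = Some m].
have mX m : measurable (X m) by exact: (measurable_record_index hp).
have -> : [set w | record_index Pi (size s).+1 w = None] `&` B = B `\` \bigcup_m X m.
  apply/seteqP; split=> w /=.
    by move=> [E Bw]; split=> // -[m _]; rewrite /X/= E.
  move=> [Bw H]; split=> //; case E : (record_index _ _ _) => [m|]//.
  by exfalso; apply: H; exists m.
have fB : P B \is a fin_num by exact: fin_num_measure.
have XB m : P (X m `&` B) = ((record_trans_fin alpha V (size s) i m)%:E * P B)%E.
  exact: record_step_fin.
(* Nonnegativity is read off from the probabilities, as P(B) > 0. *)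
have t0 m : (0 <= (record_trans_fin alpha V (size s) i m)%:E)%E.
  have : (0 <= P (X m `&` B))%E by exact: measure_ge0.
  by rewrite XB muleC pmule_rge0.
pose S := (\sum_(0 <= m <oo) (record_trans_fin alpha V (size s) i m)%:E)%E.
have SE : P (B `&` \bigcup_m X m) = (S * P B)%E.
  rewrite setI_bigcupr measure_bigcup//=; last 2 first.
  - by move=> m _; exact: measurableI.
  - by move=> m l _ _ [w [[_ Xm] [_]]]; rewrite /X/= Xm => -[].
  rewrite muleC -(fineK fB) -nneseriesZl//.
  rewrite -(eq_eseriesl (P := xpredT)); last by move=> m; rewrite in_setT.
  apply: eq_eseriesr => m _.
  by rewrite fineK// setIC XB muleC.
(* [record_trans] takes [fine] of this sum, so finiteness must be shown: the sum times P(B) > 0 is a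
   probability. *)
have fS : S \is a fin_num.
  rewrite ge0_fin_numE; last by apply: nneseries_ge0.
  rewrite ltey; apply/eqP => Soo.
  have : (P (B `&` \bigcup_m X m) < +oo)%E.
    rewrite ltey_eq fin_num_measure//; apply: measurableI => //.
    exact: bigcup_measurable.
  by rewrite SE Soo gt0_mulye.
rewrite measureD//; last by rewrite ltey_eq fB.
  rewrite [X in (_ - X)%E]SE /= -/S EFinB muleBl// mul1e fineK//.
exact: bigcup_measurable.
Qed.

End record_markov_chain.

Theorem lemma1 (d : measure_display) (T : measurableType d) (R : realType)
    (P : probability T R) (alpha : R) (V : nat -> nat -> R)
    (Pi : nat -> T -> seq {fset nat})
    (alpha_lt1 : alpha < 1) (Pi_EGP : EGP P alpha V Pi) :
  (forall (n : nat) (s : seq nat),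
     nth 0%N s 0 = 1%N -> sorted ltn s -> (last 0%N s <= n)%N ->
     P [set w | record_indices (Pi n w) = s]
     = ((psi alpha n s)^-1 * V n (size s))%:E) /\
  markov_chain P (record_index Pi) (Some 1%N) (record_trans alpha V).
Proof.
have hp := egp_partition Pi_EGP.
split; first by move=> n s; exact: (records_prob alpha_lt1 Pi_EGP).
split.
- by move=> j x _; exact: (measurable_record_index hp).
- rewrite (_ : [set _ | _] = setT) ?probability_setT//; apply/seteqP; split=> // w _ /=.
  by apply/(record_index_onth hp); exists 1%N; rewrite (records1 Pi_EGP).
move=> j h y j1 PB.
set B := [set w | _] in PB *.
have [w0 h0] : B !=set0.
  by apply/set0P/eqP => E; move: PB; rewrite E measure0 ltxx.
have mB : measurable B.
  rewrite (_ : B = \bigcap_(l in [set l | (1 <= l <= j)%N])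
      [set w | record_index Pi l w = h l])//.
  by apply: bigcap_measurableType => l _; exact: (measurable_record_index hp).
apply/cprobE => //; first exact: (measurable_record_index hp).
case hj : (h j) => [i|].
  have [s [sz sl s1 ss BE]] := history_records Pi_EGP j1 hj h0.
  move: PB; rewrite /B BE -sz => PB.
  by case: y => [i'|]; [exact: record_step_fin|exact: record_step_None].
(* From here on the current state is infinity, and no later record is finite. *)
have N w : B w -> record_index Pi j.+1 w = None.
  move=> Bw; case E : (record_index Pi j.+1 w) => [i|]//.
  have [i'] := record_index_down hp E (leqnSn j).
  by rewrite Bw ?j1 ?leqnn// hj.
case: y => [i'|] /=.
  rewrite mul0e (_ : _ `&` _ = set0) ?measure0//; apply/seteqP; split=> w //= [+ Bw].
  by rewrite N.
rewrite mul1e (_ : _ `&` _ = B)//; apply/seteqP; split=> w /=; first by case.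
by move=> Bw; split=> //; exact: N.
Qed.
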